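(* (i) For every $C^\infty$ map-germ of pedal unfolding type $\varphi:(\mathbb{R}^2,0)\to(\mathbb{R}^3,0)$, the integration $\mathcal{I}(\varphi)$ is a normalized Legendrian map-germ. (ii) For every normalized Legendrian map-germ $\Phi:(\mathbb{R}^2,0)\to(\mathbb{R}^3,0)$, the differentiation $\mathcal{D}(\Phi)$ is a map-germ of pedal unfolding type.
   Context: All germs are $C^\infty$. $(X,Y,Z)$ are the standard coordinates of $\mathbb{R}^3$. Pedal unfolding type: $\varphi:(\mathbb{R}^2,0)\to(\mathbb{R}^3,0)$ is of pedal unfolding type if $\varphi(x,y)=(n(x,y)p(x,y),p(x,y),y)$ where $n,p:(\mathbb{R}^2,0)\to(\mathbb{R},0)$ are $C^\infty$ function-germs with $\frac{\partial n}{\partial x}(0,0)\ne0$. Its integration is $\mathcal{I}(\varphi)(x,y)=\left(\int_0^x n(x,y)p(x,y)\,dx,\ \int_0^x p(x,y)\,dx,\ y\right)$. Legendrian map-germ: $\Phi:(\mathbb{R}^m,0)\to(\mathbb{R}^{m+1},0)$ is a Legendrian map-germ if there is a germ of $C^\infty$ unit vector field $\nu_\Phi:(\mathbb{R}^m,0)\to T_1\mathbb{R}^{m+1}$ along $\Phi$ ($T_1$ denotes the unit tangent bundle) such that $\frac{\partial\Phi}{\partial x_i}\cdot\nu_\Phi=0$ for $i=1,\dots,m$, and the map-germ $L_\Phi=(\Phi,\nu_\Phi):(\mathbb{R}^m,0)\to T_1\mathbb{R}^{m+1}$ is non-singular (an immersion germ). $\nu_\Phi$ is called a unit normal vector field of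 $\Phi$. Normalized: a Legendrian map-germ $\Phi:(\mathbb{R}^2,0)\to(\mathbb{R}^3,0)$ is normalized if (a) $\Phi(x,y)=(\Phi_1(x,y),\Phi_2(x,y),y)$; (b) $\frac{\partial\Phi_2}{\partial x}(0,0)=0$; (c) $\nu_\Phi(0,0)$ is $\frac{\partial}{\partial X}$ or $-\frac{\partial}{\partial X}$. Its differentiation is $\mathcal{D}(\Phi)(x,y)=\left(\frac{\partial\Phi_1}{\partial x}(x,y),\frac{\partial\Phi_2}{\partial x}(x,y),y\right)$. *)

(* Defs.v *)
From Stdlib Require Import Reals.
From Coquelicot Require Import Coquelicot.
Open Scope R_scope.

(* A germ at the origin is represented by a total function; every predicate
   below only depends on its restriction to a neighbourhood of (0,0), and
   identities between germs are identities on such a neighbourhood. *)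

Notation plane := (R * R)%type.
Notation space := (R * R * R)%type.

Definition origin : plane := (0, 0).

Definition c1 (v : space) : R := fst (fst v).
Definition c2 (v : space) : R := snd (fst v).
Definition c3 (v : space) : R := snd v.

Definition dot (u v : space) : R := c1 u * c1 v + c2 u * c2 v + c3 u * c3 v.

(* [Derive] is total, so existence of the partial derivatives is required
   separately in [C_k]. *)
Definition dx (f : plane -> R) : plane -> R :=
  fun q => Derive (fun t => f (t, snd q)) (fst q).
Definition dy (f : plane -> R) : plane -> R :=
  fun q => Derive (fun t => f (fst q, t)) (snd q).

Definition dx3 (Phi : plane -> space) : plane -> space := fun q =>
  (dx (fun z => c1 (Phi z)) q, dx (fun z => c2 (Phi z)) q,
   dx (fun z => c3 (Phi z)) q).
Definition dy3 (Phi : plane -> space) : plane -> space := fun q =>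
  (dy (fun z => c1 (Phi z)) q, dy (fun z => c2 (Phi z)) q,
   dy (fun z => c3 (Phi z)) q).

(* All iterated partial derivatives of order at most [k], in any order of
   differentiation, exist and are continuous on [U]. *)
Fixpoint C_k (k : nat) (U : plane -> Prop) (f : plane -> R) : Prop :=
  (forall q : plane, U q -> continuous f q) /\
  match k with
  | O => True
  | S j =>
      (forall q : plane, U q ->
         ex_derive (fun t : R => f (t, snd q)) (fst q) /\
         ex_derive (fun t : R => f (fst q, t)) (snd q)) /\
      C_k j U (dx f) /\ C_k j U (dy f)
  end.

(* The neighbourhood is the same for all orders. *)
Definition smooth_germ (f : plane -> R) : Prop :=
  exists U : plane -> Prop,
    open U /\ U origin /\ forall k : nat, C_k k U f.

Definition smooth_germ3 (Phi : plane -> space) : Prop :=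
  smooth_germ (fun q => c1 (Phi q)) /\
  smooth_germ (fun q => c2 (Phi q)) /\
  smooth_germ (fun q => c3 (Phi q)).

(* C^infinity germs (R^2,0) -> (R,0) and (R^2,0) -> (R^3,0). *)
Definition function_germ (f : plane -> R) : Prop :=
  smooth_germ f /\ f origin = 0.

Definition map_germ (Phi : plane -> space) : Prop :=
  smooth_germ3 Phi /\ Phi origin = (0, 0, 0).

Definition pedal_unfolding_type (phi : plane -> space) : Prop :=
  map_germ phi /\
  exists n p : plane -> R,
    function_germ n /\ function_germ p /\
    dx n origin <> 0 /\
    locally origin (fun q : plane => phi q = (n q * p q, p q, snd q)).

(* For [phi = (n p, p, y)] the integrands are [n p] and [p]. *)
Definition integration (phi : plane -> space) : plane -> space := fun q =>
  (RInt (fun t : R => c1 (phi (t, snd q))) 0 (fst q),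
   RInt (fun t : R => c2 (phi (t, snd q))) 0 (fst q),
   snd q).

Definition differentiation (Phi : plane -> space) : plane -> space := fun q =>
  (dx (fun z => c1 (Phi z)) q, dx (fun z => c2 (Phi z)) q, snd q).

(* The differential of [L] at the origin exists and is injective. *)
Definition immersion_germ (L : plane -> space * space) : Prop :=
  exists dL : plane -> space * space,
    filterdiff L (locally origin) dL /\
    forall v w : plane, dL v = dL w -> v = w.

(* T_1 R^3 is the submanifold R^3 x S^2 of R^3 x R^3, so a vector field along
   [Phi] is given by its vector part [nu], and a map into T_1 R^3 is an
   immersion iff it is one as a map into R^3 x R^3. *)
Record legendrian (Phi nu : plane -> space) : Prop := {
  legendrian_germ : map_germ Phi;
  legendrian_smooth : smooth_germ3 nu;
  legendrian_unit : locally origin (fun q : plane => dot (nu q) (nu q) = 1);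
  legendrian_dx : locally origin (fun q : plane => dot (dx3 Phi q) (nu q) = 0);
  legendrian_dy : locally origin (fun q : plane => dot (dy3 Phi q) (nu q) = 0);
  legendrian_immersion : immersion_germ (fun q => (Phi q, nu q))
}.

(* [Phi] need not determine [nu], even up to sign: being normalized means
   that some unit normal vector field making [Phi] Legendrian is
   +-d/dX at the origin. *)
Definition normalized_legendrian (Phi : plane -> space) : Prop :=
  exists nu : plane -> space,
    legendrian Phi nu /\
    locally origin (fun q : plane => c3 (Phi q) = snd q) /\
    dx (fun q => c2 (Phi q)) origin = 0 /\
    (nu origin = (1, 0, 0) \/ nu origin = (-1, 0, 0)).

(* Main.v *)
From Stdlib Require Import Reals Lra.
From Coquelicot Require Import Coquelicot.
(* The real-number library also defines a [c1]; this order of imports makes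
   [c1] denote the first coordinate in space. *)
Require Import Defs.
Open Scope R_scope.

(** Part (i).  Let [phi = (n p, p, y)] and let [F1], [F2] be the primitives in
    [x], vanishing on [x = 0], of [n p] and [p], so that the integration of
    [phi] is [(F1, F2, y)].  The field [(1, - n, w)] with
    [w = n * dy F2 - dy F1] is orthogonal to both partial derivatives
    [(n p, p, 0)] and [(dy F1, dy F2, 1)]; dividing it by its length gives
    [nu].  Since [n], [dy F1] and [dy F2] vanish at the origin, [nu] is
    [(1, 0, 0)] there, and the [x]-derivative of its second component is
    [- dx n <> 0].  Together with the third component [y] of the integration
    this makes the differential of the integration paired with [nu] injective.

    Part (ii).  Let [nu = (nu1, nu2, nu3)] be a unit normal field of
    [Phi = (a, b, y)] that is [(+-1, 0, 0)] at the origin.  Put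
    [n = - nu2 / nu1] and [p = dx b].  Orthogonality to [dx Phi] says exactly
    that [dx a = n p] near the origin.  If [dx n] vanished at the origin, then so would the
    whole [x]-derivative of [(Phi, nu)], against the immersion condition:
    - [dx a], [dx b] and [dx y] vanish there, as [n] and [p] do;
    - [dx nu2] equals [- dx n * nu1] there, which vanishes by assumption;
    - [dx nu1] vanishes by differentiating [nu . nu = 1], as [nu2] and [nu3]
      are zero at the origin;
    - [dx nu3] vanishes by differentiating [dy Phi . nu = 0], because [nu2],
      [dx nu1], [dx nu2] and [dx (dy a) = dy (dx a) = dy (n p)] are zero at the
      origin.

    What remains is that smooth germs are closed under the operations used.
    For products this is the Leibniz rule and an induction on the order of
    differentiation.  For [1 / f] and [1 / sqrt f] it is a bootstrap: both are
    [g o f] for a solution [g] of an equation [g' = c * g ^ m], so the first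
    partial derivatives of [g o f] are polynomial in [g o f] and in the partial
    derivatives of [f] ([C_k_comp_ode]).  For primitives in [x] it is
    differentiation under the integral sign ([C_k_primitive_x]). *)

(** * Partial derivatives *)

(** Existence and value of the partial derivatives at a point, as opposed to
    the total functions [dx] and [dy]. *)
Definition is_dx (f : plane -> R) (q : plane) (l : R) : Prop :=
  is_derive (fun t : R => f (t, snd q)) (fst q) l.
Definition is_dy (f : plane -> R) (q : plane) (l : R) : Prop :=
  is_derive (fun t : R => f (fst q, t)) (snd q) l.

Lemma is_dx_unique f q l : is_dx f q l -> dx f q = l.
Proof. intros H; apply is_derive_unique, H. Qed.

Lemma is_dy_unique f q l : is_dy f q l -> dy f q = l.
Proof. intros H; apply is_derive_unique, H. Qed.

Lemma locally_slice_x (P : plane -> Prop) (q : plane) :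
  locally q P -> locally (fst q) (fun t : R => P (t, snd q)).
Proof.
  destruct q as [a b]; intros [d Hd]; exists d; intros t Ht.
  apply Hd; split; [exact Ht | apply ball_center].
Qed.

Lemma locally_slice_y (P : plane -> Prop) (q : plane) :
  locally q P -> locally (snd q) (fun t : R => P (fst q, t)).
Proof.
  destruct q as [a b]; intros [d Hd]; exists d; intros t Ht.
  apply Hd; split; [apply ball_center | exact Ht].
Qed.

Lemma dx_ext_loc f g q : locally q (fun z => f z = g z) -> dx f q = dx g q.
Proof.
  intros H; apply Derive_ext_loc.
  exact (locally_slice_x (fun z => f z = g z) q H).
Qed.

Lemma dy_ext_loc f g q : locally q (fun z => f z = g z) -> dy f q = dy g q.
Proof.
  intros H; apply Derive_ext_loc.
  exact (locally_slice_y (fun z => f z = g z) q H).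
Qed.

(** * Functions of class C^k on an open set *)

Lemma open_ext_locally (U : plane -> Prop) (f g : plane -> R) q :
  open U -> (forall z, U z -> f z = g z) -> U q ->
  locally q (fun z => f z = g z).
Proof.
  intros HU H Hq; apply filter_imp with (2 := HU q Hq); exact H.
Qed.

Lemma C_k_continuous k U f q : C_k k U f -> U q -> continuous f q.
Proof. destruct k; intros [H _]; apply H. Qed.

Lemma C_k_pred k : forall U f, C_k (S k) U f -> C_k k U f.
Proof.
  induction k as [|k IH]; intros U f [Hc [Hd [Hx Hy]]]; split; auto.
Qed.

Lemma C_k_S_inv k U f :
  C_k (S k) U f ->
  (forall q, U q -> is_dx f q (dx f q) /\ is_dy f q (dy f q)) /\
  C_k k U (dx f) /\ C_k k U (dy f).
Proof.
  intros [_ [Hd H]]; split; [|exact H].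
  intros q Hq; destruct (Hd q Hq) as [H1 H2].
  split; apply Derive_correct; assumption.
Qed.

Lemma C_k_ext k : forall U f g,
  open U -> (forall q, U q -> f q = g q) -> C_k k U f -> C_k k U g.
Proof.
  induction k as [|k IH]; intros U f g HU E [Hc Hk];
    (split; [intros q Hq; apply continuous_ext_loc with (2 := Hc q Hq);
             exact (open_ext_locally U f g q HU E Hq)|]).
  - exact I.
  - destruct Hk as [Hd [Hx Hy]]; split; [|split].
    + intros q Hq; destruct (Hd q Hq) as [H1 H2].
      pose proof (open_ext_locally U f g q HU E Hq) as L.
      split.
      * apply ex_derive_ext_loc with (2 := H1).
        exact (locally_slice_x (fun z => f z = g z) q L).
      * apply ex_derive_ext_loc with (2 := H2).
        exact (locally_slice_y (fun z => f z = g z) q L).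
    + apply IH with (3 := Hx); [exact HU|].
      intros q Hq; apply dx_ext_loc, (open_ext_locally U); assumption.
    + apply IH with (3 := Hy); [exact HU|].
      intros q Hq; apply dy_ext_loc, (open_ext_locally U); assumption.
Qed.

(** To prove [C_k (S k)] it is enough to exhibit functions that agree with the
    partial derivatives on [U] and are of class [C_k]. *)
Lemma C_k_S_intro k U f gx gy :
  open U ->
  (forall q, U q -> continuous f q) ->
  (forall q, U q -> is_dx f q (gx q)) ->
  (forall q, U q -> is_dy f q (gy q)) ->
  C_k k U gx -> C_k k U gy -> C_k (S k) U f.
Proof.
  intros HU Hc Hx Hy Cx Cy; split; [exact Hc|split; [|split]].
  - intros q Hq; split; eexists; [apply Hx | apply Hy]; exact Hq.
  - apply C_k_ext with (3 := Cx); [exact HU|].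
    intros q Hq; symmetry; apply is_dx_unique, Hx, Hq.
  - apply C_k_ext with (3 := Cy); [exact HU|].
    intros q Hq; symmetry; apply is_dy_unique, Hy, Hq.
Qed.

Lemma C_k_subset k : forall (U V : plane -> Prop) f,
  (forall q, V q -> U q) -> C_k k U f -> C_k k V f.
Proof.
  induction k as [|k IH]; intros U V f HV [Hc Hk]; split; auto.
  destruct Hk as [Hd [Hx Hy]]; split; [auto|].
  split; apply IH with U; assumption.
Qed.

Lemma C_k_const k : forall U c, open U -> C_k k U (fun _ => c).
Proof.
  induction k as [|k IH]; intros U c HU.
  - split; [|exact I]; intros; apply continuous_const.
  - apply C_k_S_intro with (gx := fun _ => 0) (gy := fun _ => 0); auto.
    + intros; apply continuous_const.
    + intros; apply (is_derive_const c).
    + intros; apply (is_derive_const c).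
Qed.

Lemma C_k_snd k U : open U -> C_k k U snd.
Proof.
  intros HU; destruct k as [|k].
  - split; [|exact I]; intros; apply continuous_snd.
  - apply C_k_S_intro with (gx := fun _ => 0) (gy := fun _ => 1);
      try apply C_k_const; auto.
    + intros; apply continuous_snd.
    + intros q _; apply (is_derive_const (snd q)).
    + intros q _; apply (is_derive_id (snd q)).
Qed.

Lemma is_dx_plus f g q a b :
  is_dx f q a -> is_dx g q b -> is_dx (fun z => f z + g z) q (a + b).
Proof. apply (is_derive_plus (fun t => f (t, snd q)) (fun t => g (t, snd q))). Qed.

Lemma is_dy_plus f g q a b :
  is_dy f q a -> is_dy g q b -> is_dy (fun z => f z + g z) q (a + b).
Proof. apply (is_derive_plus (fun t => f (fst q, t)) (fun t => g (fst q, t))). Qed.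

Lemma is_dx_opp f q a : is_dx f q a -> is_dx (fun z => - f z) q (- a).
Proof. apply (is_derive_opp (fun t => f (t, snd q))). Qed.

Lemma is_dx_mult f g q a b :
  is_dx f q a -> is_dx g q b ->
  is_dx (fun z => f z * g z) q (a * g q + f q * b).
Proof.
  intros Hf Hg; pose proof (Derive.is_derive_mult _ _ _ _ _ Hf Hg) as H.
  cbv beta in H; rewrite <- surjective_pairing in H; exact H.
Qed.

Lemma is_dy_mult f g q a b :
  is_dy f q a -> is_dy g q b ->
  is_dy (fun z => f z * g z) q (a * g q + f q * b).
Proof.
  intros Hf Hg; pose proof (Derive.is_derive_mult _ _ _ _ _ Hf Hg) as H.
  cbv beta in H; rewrite <- surjective_pairing in H; exact H.
Qed.

Lemma C_k_plus k : forall U f g,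
  open U -> C_k k U f -> C_k k U g -> C_k k U (fun q => f q + g q).
Proof.
  induction k as [|k IH]; intros U f g HU Hf Hg.
  - split; [|exact I]; intros q Hq.
    apply (continuous_plus f g); [apply Hf | apply Hg]; exact Hq.
  - destruct (C_k_S_inv _ _ _ Hf) as [Df [Fx Fy]].
    destruct (C_k_S_inv _ _ _ Hg) as [Dg [Gx Gy]].
    apply C_k_S_intro with (gx := fun q => dx f q + dx g q)
                           (gy := fun q => dy f q + dy g q); auto.
    + intros q Hq; apply (continuous_plus f g); [apply Hf | apply Hg]; exact Hq.
    + intros q Hq.
      apply is_dx_plus; [apply Df | apply Dg]; exact Hq.
    + intros q Hq.
      apply is_dy_plus; [apply Df | apply Dg]; exact Hq.
Qed.

Lemma C_k_mult k : forall U f g,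
  open U -> C_k k U f -> C_k k U g -> C_k k U (fun q => f q * g q).
Proof.
  induction k as [|k IH]; intros U f g HU Hf Hg.
  - split; [|exact I]; intros q Hq.
    apply (continuous_mult f g); [apply Hf | apply Hg]; exact Hq.
  - destruct (C_k_S_inv _ _ _ Hf) as [Df [Fx Fy]].
    destruct (C_k_S_inv _ _ _ Hg) as [Dg [Gx Gy]].
    pose proof (C_k_pred _ _ _ Hf) as Hf'.
    pose proof (C_k_pred _ _ _ Hg) as Hg'.
    apply C_k_S_intro with (gx := fun q => dx f q * g q + f q * dx g q)
                           (gy := fun q => dy f q * g q + f q * dy g q);
      auto using C_k_plus.
    + intros q Hq; apply (continuous_mult f g); [apply Hf | apply Hg]; exact Hq.
    + intros q Hq; apply is_dx_mult; [apply Df | apply Dg]; exact Hq.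
    + intros q Hq; apply is_dy_mult; [apply Df | apply Dg]; exact Hq.
Qed.

Lemma C_k_pow k m U f : open U -> C_k k U f -> C_k k U (fun q => f q ^ m).
Proof.
  intros HU Hf; induction m as [|m IH]; simpl.
  - apply C_k_const, HU.
  - apply C_k_mult; assumption.
Qed.

(** Composition with a solution [g] of an autonomous equation [g' = c * g ^ m]
    on [P]: the partial derivatives of [g o f] are again expressed by [g o f],
    which makes the induction on [k] possible without derivatives of [g] of
    higher order. *)
Lemma C_k_comp_ode k : forall U f (P : R -> Prop) (g : R -> R) c m,
  open U -> (forall t, P t -> is_derive g t (c * g t ^ m)) ->
  (forall q, U q -> P (f q)) -> C_k k U f -> C_k k U (fun q => g (f q)).
Proof.
  induction k as [|k IH]; intros U f P g c m HU Hg HP Hf;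
    assert (Hc : forall q, U q -> continuous (fun z => g (f z)) q)
      by (intros q Hq; apply continuous_comp;
          [exact (C_k_continuous _ _ _ _ Hf Hq)
          |apply (ex_derive_continuous g); eexists; apply Hg, HP, Hq]).
  - split; [exact Hc | exact I].
  - destruct (C_k_S_inv _ _ _ Hf) as [Df [Fx Fy]].
    pose proof (IH U f P g c m HU Hg HP (C_k_pred _ _ _ Hf)) as Hgf.
    assert (Hw : C_k k U (fun q => c * g (f q) ^ m)).
    { apply (C_k_mult k U (fun _ => c) (fun q => g (f q) ^ m));
        auto using C_k_const.
      apply (C_k_pow k m U (fun q => g (f q))); assumption. }
    apply C_k_S_intro with (gx := fun q => dx f q * (c * g (f q) ^ m))
                           (gy := fun q => dy f q * (c * g (f q) ^ m));
      auto using C_k_mult.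
    + intros q Hq; apply (is_derive_comp g (fun t => f (t, snd q)));
        [rewrite <- surjective_pairing; apply Hg, HP, Hq | apply Df, Hq].
    + intros q Hq; apply (is_derive_comp g (fun t => f (fst q, t)));
        [rewrite <- surjective_pairing; apply Hg, HP, Hq | apply Df, Hq].
Qed.

(** * Primitives with respect to the first variable *)

Lemma continuous_slice_x (f : plane -> R) (q : plane) :
  continuous f q -> continuous (fun t : R => f (t, snd q)) (fst q).
Proof.
  intros H P HP; rewrite <- surjective_pairing in HP.
  exact (locally_slice_x (fun z => P (f z)) q (H P HP)).
Qed.

(** The open square of half-side [r] centred at the origin.  Unlike a general
    open set, it contains the segment joining [(0, y)] to any of its points
    [(x, y)]. *)
Definition box (r : R) (q : plane) : Prop := Rabs (fst q) < r /\ Rabs (snd q) < r.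

Lemma open_box r : open (box r).
Proof.
  apply open_and.
  - apply (open_comp (fun q : plane => Rabs (fst q)) (fun u => u < r));
      [intros q _ | apply open_lt].
    apply (continuous_comp fst Rabs); [apply continuous_fst | apply continuous_Rabs].
  - apply (open_comp (fun q : plane => Rabs (snd q)) (fun u => u < r));
      [intros q _ | apply open_lt].
    apply (continuous_comp snd Rabs); [apply continuous_snd | apply continuous_Rabs].
Qed.

Lemma box_origin r : 0 < r -> box r origin.
Proof. intros H; split; simpl; rewrite Rabs_R0; exact H. Qed.

Lemma locally_box (P : plane -> Prop) :
  locally origin P -> exists r, 0 < r /\ forall q, box r q -> P q.
Proof.
  intros [d Hd]; exists d; split; [apply cond_pos|].
  intros [u v] [Hu Hv]; apply Hd; split; simpl in *;
    unfold ball; simpl; unfold AbsRing_ball, abs, minus, plus, opp; simpl;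
    rewrite Ropp_0, Rplus_0_r; assumption.
Qed.

Lemma box_segment r (q : plane) t :
  box r q -> Rmin 0 (fst q) <= t <= Rmax 0 (fst q) -> box r (t, snd q).
Proof.
  intros [Hx Hy] Ht; split; [simpl|exact Hy].
  revert Hx Ht; unfold Rmin, Rmax.
  destruct (Rle_dec 0 (fst q)); unfold Rabs;
    repeat destruct (Rcase_abs _); lra.
Qed.

(** The primitive of [f] in [x] that vanishes on the axis [x = 0]. *)
Definition primitive_x (f : plane -> R) : plane -> R :=
  fun q => RInt (fun t : R => f (t, snd q)) 0 (fst q).

Lemma ex_RInt_box r (f : plane -> R) q :
  (forall z, box r z -> continuous f z) ->
  box r q -> ex_RInt (fun t => f (t, snd q)) 0 (fst q).
Proof.
  intros f_cont Hq; apply (ex_RInt_continuous (V := R_CompleteNormedModule)).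
  intros t Ht; apply (continuous_slice_x f (t, snd q)).
  apply f_cont, box_segment; assumption.
Qed.

Lemma is_dx_primitive_x r (f : plane -> R) q :
  (forall z, box r z -> continuous f z) ->
  box r q -> is_dx (primitive_x f) q (f q).
Proof.
  intros f_cont Hq; unfold is_dx, primitive_x; simpl.
  replace (f q) with ((fun t => f (t, snd q)) (fst q))
    by (rewrite <- surjective_pairing; reflexivity).
  apply (is_derive_RInt (fun t => f (t, snd q)) _ 0 (fst q)).
  - apply filter_imp with (fun t => box r (t, snd q)).
    + intros t Ht; apply (RInt_correct (V := R_CompleteNormedModule)).
      exact (ex_RInt_box r f (t, snd q) f_cont Ht).
    + apply (locally_slice_x (box r) q), open_box, Hq.
  - apply continuous_slice_x, f_cont, Hq.
Qed.

Lemma Rabs_RInt_0_le (g : R -> R) x M :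
  ex_RInt g 0 x -> (forall t, Rmin 0 x <= t <= Rmax 0 x -> Rabs (g t) <= M) ->
  Rabs (RInt g 0 x) <= Rabs x * M.
Proof.
  intros Hg HM; destruct (Rle_dec 0 x) as [Hx|Hx].
  - rewrite Rmin_left, Rmax_right in HM by exact Hx.
    rewrite (Rabs_pos_eq x Hx).
    pose proof (abs_RInt_le_const g 0 x M Hx Hg HM); lra.
  - rewrite Rmin_right, Rmax_left in HM by lra.
    rewrite (Rabs_left x) by lra.
    pose proof (abs_RInt_le_const g x 0 M ltac:(lra) (ex_RInt_swap _ _ _ Hg) HM) as H.
    rewrite <- (opp_RInt_swap (V := R_CompleteNormedModule)) in H by exact Hg.
    unfold opp in H; simpl in H; rewrite Rabs_Ropp in H; lra.
Qed.

(** Split the increment into a change of [y] in the integrand, small by uniform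
    continuity of [f] near a segment of the line through [(x0, y0)] parallel
    to the [x]-axis, and a change of the upper bound of the integral. *)
Lemma continuous_primitive_x r (f : plane -> R) q :
  (forall z, box r z -> continuous f z) ->
  box r q -> continuous (primitive_x f) q.
Proof.
  intros f_cont Hq; destruct q as [x0 y0].
  assert (Hx0 : Rabs x0 < r) by apply Hq.
  assert (Hy0 : Rabs y0 < r) by apply Hq.
  (* The segment has to contain a neighbourhood of [x0] and still lie in the
     square. *)
  set (b := (Rabs x0 + r) / 2).
  assert (Hr : 0 < r) by (pose proof (Rabs_pos x0); lra).
  assert (Hu : forall x, - b <= x <= b ->
            continuity_2d_pt (fun u v => f (u, v)) x y0).
  { intros x Hx; apply continuity_2d_pt_filterlim.
    apply filterlim_ext with f; [intros [u v]; reflexivity|].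
    apply f_cont; split; [simpl|exact Hy0].
    apply Rle_lt_trans with b; [apply Rabs_le; exact Hx | unfold b; lra]. }
  assert (Hc : continuity_2d_pt (fun u v => primitive_x f (u, v)) x0 y0).
  2:{ apply continuity_2d_pt_filterlim in Hc.
      apply filterlim_ext with (2 := Hc); intros [u v]; reflexivity. }
  intros eps.
  assert (He1 : 0 < eps / (2 * r))
    by (apply Rdiv_lt_0_compat; [apply cond_pos | lra]).
  destruct (uniform_continuity_2d_1d (fun u v => f (u, v)) (- b) b y0 Hu
              (mkposreal _ He1)) as [d1 H1]; simpl in H1.
  assert (H2 : continuous (fun u => primitive_x f (u, y0)) x0)
    by (apply (ex_derive_continuous (fun u => primitive_x f (u, y0)));
        exists (f (x0, y0)); exact (is_dx_primitive_x r f (x0, y0) f_cont Hq)).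
  apply continuity_pt_filterlim in H2.
  pose proof (proj1 (continuity_pt_locally (fun u => primitive_x f (u, y0)) x0) H2) as H2'.
  destruct (H2' (pos_div_2 eps)) as [d2 Hd2]; simpl in Hd2.
  assert (Hd : 0 < Rmin (Rmin d1 d2) (Rmin (b - Rabs x0) (r - Rabs y0))).
  { repeat apply Rmin_pos; try apply cond_pos; unfold b; lra. }
  exists (mkposreal _ Hd); simpl; intros u v Hu' Hv'.
  pose proof (Rmin_l (Rmin d1 d2) (Rmin (b - Rabs x0) (r - Rabs y0))).
  pose proof (Rmin_r (Rmin d1 d2) (Rmin (b - Rabs x0) (r - Rabs y0))).
  pose proof (Rmin_l d1 d2); pose proof (Rmin_r d1 d2).
  pose proof (Rmin_l (b - Rabs x0) (r - Rabs y0)).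
  pose proof (Rmin_r (b - Rabs x0) (r - Rabs y0)).
  assert (Hub : Rabs u <= b)
    by (replace u with (u - x0 + x0) by ring;
        pose proof (Rabs_triang (u - x0) x0); lra).
  assert (Hvr : Rabs v < r)
    by (replace v with (v - y0 + y0) by ring;
        pose proof (Rabs_triang (v - y0) y0); lra).
  assert (Hur : Rabs u < r) by (unfold b in *; lra).
  assert (HA : ex_RInt (fun t => f (t, v)) 0 u)
    by (exact (ex_RInt_box r f (u, v) f_cont (conj Hur Hvr))).
  assert (HB : ex_RInt (fun t => f (t, y0)) 0 u)
    by (exact (ex_RInt_box r f (u, y0) f_cont (conj Hur Hy0))).
  assert (Hdiff : Rabs (primitive_x f (u, v) - primitive_x f (u, y0)) <=
                    Rabs u * (eps / (2 * r))).
  { unfold primitive_x; simpl.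
    rewrite <- (RInt_minus (V := R_CompleteNormedModule)) by assumption.
    apply Rabs_RInt_0_le.
    - apply (ex_RInt_minus (V := R_NormedModule)); assumption.
    - intros t Ht; left; unfold minus, plus, opp; simpl.
      assert (Htb : - b <= t <= b).
      { apply Rabs_le_between.
        revert Hub Ht; unfold Rmin, Rmax.
        destruct (Rle_dec 0 u); unfold Rabs;
          repeat destruct (Rcase_abs _); lra. }
      apply H1; try assumption.
      + pose proof (cond_pos d1); lra.
      + apply Rabs_le_between'; lra.
      + rewrite Rminus_diag, Rabs_R0; apply cond_pos. }
  assert (Hlt : Rabs u * (eps / (2 * r)) <= eps / 2).
  { replace (eps / 2) with (r * (eps / (2 * r))) by (field; lra).
    apply Rmult_le_compat_r; lra. }
  assert (Hx_lt : Rabs (primitive_x f (u, y0) - primitive_x f (x0, y0)) < eps / 2)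
    by (apply Hd2; unfold ball; simpl; unfold AbsRing_ball; simpl;
        apply Rlt_le_trans with (1 := Hu'); lra).
  replace (primitive_x f (u, v) - primitive_x f (x0, y0))
    with ((primitive_x f (u, v) - primitive_x f (u, y0)) +
          (primitive_x f (u, y0) - primitive_x f (x0, y0)))
    by ring.
  eapply Rle_lt_trans; [apply Rabs_triang | lra].
Qed.

Lemma is_dy_primitive_x r (f : plane -> R) q :
  (forall z, box r z -> continuous f z) ->
  (forall z, box r z -> is_dy f z (dy f z)) ->
  (forall z, box r z -> continuous (dy f) z) ->
  box r q -> is_dy (primitive_x f) q (primitive_x (dy f) q).
Proof.
  intros f_cont Hd Hdc Hq.
  assert (HL : locally (snd q) (fun v => box r (fst q, v)))
    by (apply (locally_slice_y (box r) q), open_box, Hq).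
  apply (is_derive_RInt_param (fun v t => f (t, v)) 0 (fst q) (snd q)).
  - apply filter_imp with (2 := HL); intros v Hv t Ht.
    exists (dy f (t, v)); apply (Hd (t, v)).
    exact (box_segment r (fst q, v) t Hv Ht).
  - intros t Ht; apply continuity_2d_pt_filterlim; simpl.
    (* The parameter of the integral comes first, so the variables of [dy f]
       are exchanged. *)
    apply (continuous_comp_2 (fun z : plane => snd z) (fun z : plane => fst z)
             (fun a b => dy f (a, b)) (snd q, t)).
    + apply continuous_snd.
    + apply continuous_fst.
    + simpl; apply continuous_ext with (dy f); [intros [a b]; reflexivity|].
      apply Hdc, (box_segment r q t Hq Ht).
  - apply filter_imp with (2 := HL); intros v Hv.
    exact (ex_RInt_box r f (fst q, v) f_cont Hv).
Qed.

Lemma C_k_primitive_x r k : forall f, C_k k (box r) f -> C_k k (box r) (primitive_x f).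
Proof.
  induction k as [|k IH]; intros f Hf.
  - split; [|exact I]; intros q Hq; apply (continuous_primitive_x r); [apply Hf | exact Hq].
  - destruct (C_k_S_inv _ _ _ Hf) as [Df [_ Fy]].
    assert (Hc : forall q, box r q -> continuous f q) by apply Hf.
    apply C_k_S_intro with (gx := f) (gy := primitive_x (dy f)).
    + apply open_box.
    + intros q Hq; apply (continuous_primitive_x r); assumption.
    + intros q Hq; apply (is_dx_primitive_x r); assumption.
    + intros q Hq; apply (is_dy_primitive_x r); auto.
      * intros z Hz; apply Df, Hz.
      * intros z Hz; exact (C_k_continuous _ _ _ _ Fy Hz).
    + apply C_k_pred, Hf.
    + apply IH, Fy.
Qed.

(** * Smooth germs *)

Lemma smooth_germ_locally f :
  smooth_germ f ->
  locally origin (fun q => continuous f q /\ is_dx f q (dx f q) /\ is_dy f q (dy f q)).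
Proof.
  intros [U [HU [HO Hf]]]; apply filter_imp with (2 := HU origin HO).
  intros q Hq; split; [exact (C_k_continuous 0 U f q (Hf 0%nat) Hq)|].
  exact (proj1 (C_k_S_inv 0 U f (Hf 1%nat)) q Hq).
Qed.

Lemma smooth_germ_is_dx f : smooth_germ f -> is_dx f origin (dx f origin).
Proof. intros H; exact (proj1 (proj2 (locally_singleton _ _ (smooth_germ_locally f H)))). Qed.

Lemma smooth_germ_is_dy f : smooth_germ f -> is_dy f origin (dy f origin).
Proof. intros H; exact (proj2 (proj2 (locally_singleton _ _ (smooth_germ_locally f H)))). Qed.

Lemma smooth_germ_continuous f : smooth_germ f -> continuous f origin.
Proof. intros H; exact (proj1 (locally_singleton _ _ (smooth_germ_locally f H))). Qed.

Lemma smooth_germ_dx f : smooth_germ f -> smooth_germ (dx f).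
Proof.
  intros [U [HU [HO Hf]]]; exists U; repeat split; auto.
  intros k; apply (C_k_S_inv k U f (Hf (S k))).
Qed.

Lemma smooth_germ_dy f : smooth_germ f -> smooth_germ (dy f).
Proof.
  intros [U [HU [HO Hf]]]; exists U; repeat split; auto.
  intros k; apply (C_k_S_inv k U f (Hf (S k))).
Qed.

Lemma smooth_germ_ext f g :
  locally origin (fun q => f q = g q) -> smooth_germ f -> smooth_germ g.
Proof.
  intros E [U [HU [HO Hf]]]; destruct (locally_box _ E) as [r [Hr Hbox]].
  exists (fun q => U q /\ box r q).
  assert (HV : open (fun q => U q /\ box r q)) by (apply open_and; [exact HU | apply open_box]).
  repeat split; auto using box_origin; try (apply box_origin, Hr).
  intros k; apply C_k_ext with f; [exact HV | intros q [_ Hq]; apply Hbox, Hq|].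
  apply C_k_subset with U; [tauto | apply Hf].
Qed.

Lemma smooth_germ_const c : smooth_germ (fun _ => c).
Proof.
  exists (fun _ => True); repeat split; try apply open_true.
  intros k; apply C_k_const, open_true.
Qed.

Lemma smooth_germ_snd : smooth_germ snd.
Proof.
  exists (fun _ => True); repeat split; try apply open_true.
  intros k; apply C_k_snd, open_true.
Qed.

Lemma smooth_germ_common f g :
  smooth_germ f -> smooth_germ g ->
  exists U, open U /\ U origin /\ (forall k, C_k k U f) /\ (forall k, C_k k U g).
Proof.
  intros [U [HU [HO Hf]]] [V [HV [HO' Hg]]].
  exists (fun q => U q /\ V q); split; [apply open_and; assumption|].
  split; [auto|]; split; intros k;
    [apply C_k_subset with U | apply C_k_subset with V]; auto; tauto.
Qed.

Lemma smooth_germ_plus f g :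
  smooth_germ f -> smooth_germ g -> smooth_germ (fun q => f q + g q).
Proof.
  intros Hf Hg; destruct (smooth_germ_common f g Hf Hg) as [U [HU [HO [Cf Cg]]]].
  exists U; repeat split; auto using C_k_plus.
Qed.

Lemma smooth_germ_mult f g :
  smooth_germ f -> smooth_germ g -> smooth_germ (fun q => f q * g q).
Proof.
  intros Hf Hg; destruct (smooth_germ_common f g Hf Hg) as [U [HU [HO [Cf Cg]]]].
  exists U; repeat split; auto using C_k_mult.
Qed.

Lemma smooth_germ_opp f : smooth_germ f -> smooth_germ (fun q => - f q).
Proof.
  intros Hf; apply smooth_germ_ext with (fun q => (-1) * f q).
  - apply filter_forall; intros q; ring.
  - apply (smooth_germ_mult (fun _ => -1) f); [apply smooth_germ_const | exact Hf].
Qed.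

Lemma smooth_germ_comp_ode (P : R -> Prop) (g : R -> R) c m f :
  open P -> (forall t, P t -> is_derive g t (c * g t ^ m)) ->
  P (f origin) -> smooth_germ f -> smooth_germ (fun q => g (f q)).
Proof.
  intros HP Hg H0 Hf.
  assert (HL : locally origin (fun q => P (f q)))
    by (apply (smooth_germ_continuous f Hf), HP, H0).
  destruct Hf as [U [HU [HO Hf]]].
  destruct (locally_box _ HL) as [r [Hr Hbox]].
  exists (fun q => U q /\ box r q).
  assert (HV : open (fun q => U q /\ box r q)) by (apply open_and; [exact HU | apply open_box]).
  repeat split; auto; try (apply box_origin, Hr).
  intros k; apply (C_k_comp_ode k _ f P g c m HV Hg).
  - intros q [_ Hq]; apply Hbox, Hq.
  - apply C_k_subset with U; [tauto | apply Hf].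
Qed.

(** [1 / t] solves [g' = - g ^ 2] where [t <> 0]. *)
Lemma smooth_germ_inv f :
  f origin <> 0 -> smooth_germ f -> smooth_germ (fun q => / f q).
Proof.
  apply (smooth_germ_comp_ode (fun t => t <> 0) Rinv (-1) 2).
  - apply open_neq.
  - intros t Ht.
    replace (-1 * (/ t) ^ 2) with (- 1 / t ^ 2) by (field; exact Ht).
    apply (is_derive_inv (fun t => t)); [apply (is_derive_id t) | exact Ht].
Qed.

(** [1 / sqrt t] solves [g' = - g ^ 3 / 2] where [0 < t]. *)
Lemma smooth_germ_inv_sqrt f :
  0 < f origin -> smooth_germ f -> smooth_germ (fun q => / sqrt (f q)).
Proof.
  apply (smooth_germ_comp_ode (fun t => 0 < t) (fun t => / sqrt t) (- / 2) 3).
  - apply open_gt.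
  - intros t Ht; pose proof (sqrt_lt_R0 t Ht) as Hs.
    replace (- / 2 * (/ sqrt t) ^ 3) with (- (1 / (2 * sqrt t)) / sqrt t ^ 2)
      by (field; lra).
    apply is_derive_inv; [|lra].
    apply (is_derive_sqrt (fun t => t)); [apply (is_derive_id t) | exact Ht].
Qed.

Lemma smooth_germ_box f :
  smooth_germ f -> exists r, 0 < r /\ forall k, C_k k (box r) f.
Proof.
  intros [U [HU [HO Hf]]]; destruct (locally_box U (HU _ HO)) as [r [Hr HrU]].
  exists r; split; [exact Hr|]; intros k; exact (C_k_subset k U (box r) f HrU (Hf k)).
Qed.

Lemma smooth_germ_primitive_x f : smooth_germ f -> smooth_germ (primitive_x f).
Proof.
  intros Hf; destruct (smooth_germ_box f Hf) as [r [Hr Cf]].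
  exists (box r); repeat split; auto using open_box, C_k_primitive_x;
    apply box_origin, Hr.
Qed.

Lemma dx_primitive_x f : smooth_germ f -> locally origin (fun q => dx (primitive_x f) q = f q).
Proof.
  intros Hf; destruct (smooth_germ_box f Hf) as [r [Hr Cf]].
  apply filter_imp with (box r); [|apply open_box, box_origin, Hr].
  intros q Hq; apply is_dx_unique, (is_dx_primitive_x r); [|exact Hq].
  intros z Hz; exact (C_k_continuous 0 _ _ _ (Cf 0%nat) Hz).
Qed.

Lemma dy_primitive_x_origin f : dy (primitive_x f) origin = 0.
Proof.
  unfold dy, primitive_x, origin; simpl.
  transitivity (Derive (fun _ : R => 0) 0); [|apply Derive_const].
  apply Derive_ext; intros t.
  apply (RInt_point (V := R_CompleteNormedModule)).
Qed.

Lemma smooth_germ_schwarz f :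
  smooth_germ f -> dx (dy f) origin = dy (dx f) origin.
Proof.
  intros Hf.
  apply (Schwarz (fun u v => f (u, v)) 0 0).
  - apply locally_2d_locally.
    generalize (smooth_germ_locally f Hf)
      (smooth_germ_locally _ (smooth_germ_dx f Hf))
      (smooth_germ_locally _ (smooth_germ_dy f Hf)).
    intros H1 H2 H3.
    generalize (filter_and _ _ H1 (filter_and _ _ H2 H3)); apply filter_imp.
    intros [u v] [[_ [A1 A2]] [[_ [_ B2]] [_ [C1 _]]]]; simpl.
    repeat split; eexists; [exact A1 | exact A2 | exact C1 | exact B2].
  - apply continuity_2d_pt_filterlim.
    apply filterlim_ext with (dx (dy f)); [intros [u v]; reflexivity|].
    apply (smooth_germ_continuous _ (smooth_germ_dx _ (smooth_germ_dy f Hf))).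
  - apply continuity_2d_pt_filterlim.
    apply filterlim_ext with (dy (dx f)); [intros [u v]; reflexivity|].
    apply (smooth_germ_continuous _ (smooth_germ_dy _ (smooth_germ_dx f Hf))).
Qed.

(** * Differentials at the origin *)

(** The differential at the origin of a real function, and below of a map to
    space, expressed by its partial derivatives. *)
Definition linear_part (f : plane -> R) (v : plane) : R :=
  fst v * dx f origin + snd v * dy f origin.

Lemma smooth_germ_filterdiff f :
  smooth_germ f ->
  filterdiff f (locally origin) (linear_part f).
Proof.
  intros Hf.
  apply filterdiff_ext with (fun u : plane => f (fst u, snd u));
    [intros [u v]; reflexivity|].
  apply (is_derive_filterdiff (fun u v => f (u, v)) 0 0 (fun u v => dx f (u, v))).
  - generalize (smooth_germ_locally f Hf); apply filter_imp.
    intros [u v] [_ [H _]]; exact H.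
  - exact (smooth_germ_is_dy f Hf).
  - apply continuous_ext with (dx f); [intros [u v]; reflexivity|].
    exact (smooth_germ_continuous _ (smooth_germ_dx f Hf)).
Qed.

Lemma filterdiff_pair {T U V : NormedModule R_AbsRing} (f : T -> U) (g : T -> V)
  (x : T) (lf : T -> U) (lg : T -> V) :
  filterdiff f (locally x) lf -> filterdiff g (locally x) lg ->
  filterdiff (fun t => (f t, g t)) (locally x) (fun t => (lf t, lg t)).
Proof.
  intros Hf Hg.
  apply (filterdiff_comp'_2 f g (fun a b => (a, b)) x lf lg (fun a b => (a, b)) Hf Hg).
  apply filterdiff_ext with (fun t => t); [intros [a b]; reflexivity|].
  apply filterdiff_ext_lin with (fun t => t); [|intros [a b]; reflexivity].
  apply filterdiff_id.
Qed.

Definition linear_part3 (F : plane -> space) (v : plane) : space :=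
  (linear_part (fun q => c1 (F q)) v, linear_part (fun q => c2 (F q)) v,
   linear_part (fun q => c3 (F q)) v).

Lemma smooth_germ3_filterdiff F :
  smooth_germ3 F -> filterdiff F (locally origin) (linear_part3 F).
Proof.
  intros [H1 [H2 H3]].
  apply filterdiff_ext with (fun q => (c1 (F q), c2 (F q), c3 (F q))).
  - intros q; destruct (F q) as [[a b] c]; reflexivity.
  - apply (filterdiff_pair (fun q => (c1 (F q), c2 (F q))) (fun q => c3 (F q)));
      [apply (filterdiff_pair (fun q => c1 (F q)) (fun q => c2 (F q)))|];
      apply smooth_germ_filterdiff; assumption.
Qed.

Lemma is_derive_fst {U V : NormedModule R_AbsRing} (f : R -> U * V) x (l : U * V) :
  is_derive f x l -> is_derive (fun t => fst (f t)) x (fst l).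
Proof.
  intros H; apply (filterdiff_comp' f fst x _ fst H).
  apply filterdiff_linear, is_linear_fst.
Qed.

Lemma is_derive_snd {U V : NormedModule R_AbsRing} (f : R -> U * V) x (l : U * V) :
  is_derive f x l -> is_derive (fun t => snd (f t)) x (snd l).
Proof.
  intros H; apply (filterdiff_comp' f snd x _ snd H).
  apply filterdiff_linear, is_linear_snd.
Qed.

(** The value of a differential on the first basis vector is the partial
    derivative in [x]. *)
Lemma filterdiff_is_derive_x {V : NormedModule R_AbsRing} (L dL : plane -> V) :
  filterdiff L (locally origin) dL ->
  is_derive (fun t => L (t, 0)) 0 (dL (1, 0)).
Proof.
  intros H; unfold is_derive.
  apply filterdiff_ext_lin with (fun t : R => dL (t, 0)).
  - apply (filterdiff_comp' (fun t : R => (t, 0)) L 0 (fun t : R => (t, 0)) dL).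
    2: exact H.
    apply (filterdiff_pair (fun t : R => t) (fun _ : R => 0) 0
             (fun t : R => t) (fun _ : R => 0)).
    + apply filterdiff_id.
    + apply (filterdiff_const (0 : R_NormedModule)).
  - intros y; rewrite <- (linear_scal _ (proj1 H)); f_equal.
    apply injective_projections;
      [exact (eq_sym (Rmult_1_r y)) | exact (eq_sym (Rmult_0_r y))].
Qed.

(** * Integration of map-germs of pedal unfolding type *)

Lemma integration_normalized phi :
  pedal_unfolding_type phi -> normalized_legendrian (integration phi).
Proof.
  intros [[[S1 [S2 _]] _] [n [p [[Sn n0] [[_ p0] [nx0 E]]]]]].
  set (f1 := fun q => c1 (phi q)) in *.
  set (f2 := fun q => c2 (phi q)) in *.
  pose proof (smooth_germ_primitive_x f1 S1) as SF1.
  pose proof (smooth_germ_primitive_x f2 S2) as SF2.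
  set (F1 := primitive_x f1) in *; set (F2 := primitive_x f2) in *.
  (* [(1, - n, w)] is normal to the integration, [D] is its squared length and
     [h] the factor that normalizes it. *)
  set (w := fun q => n q * dy F2 q + - dy F1 q).
  assert (Sw : smooth_germ w).
  { apply (smooth_germ_plus (fun q => n q * dy F2 q) (fun q => - dy F1 q)).
    - apply (smooth_germ_mult n (dy F2)); auto using smooth_germ_dy.
    - apply (smooth_germ_opp (dy F1)), smooth_germ_dy, SF1. }
  assert (w0 : w origin = 0).
  { unfold w, F1, F2; rewrite 2!dy_primitive_x_origin; ring. }
  set (D := fun q => 1 + (n q * n q + w q * w q)).
  assert (HD : forall q, 0 < D q).
  { intros q; unfold D; pose proof (Rle_0_sqr (n q)); pose proof (Rle_0_sqr (w q)).
    unfold Rsqr in *; lra. }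
  assert (SD : smooth_germ D).
  { apply (smooth_germ_plus (fun _ => 1) (fun q => n q * n q + w q * w q));
      [apply smooth_germ_const|].
    apply (smooth_germ_plus (fun q => n q * n q) (fun q => w q * w q));
      apply smooth_germ_mult; assumption. }
  set (h := fun q => / sqrt (D q)).
  assert (Sh : smooth_germ h) by (apply smooth_germ_inv_sqrt; auto).
  assert (hD : forall q, h q * h q * D q = 1).
  { intros q; unfold h; pose proof (sqrt_lt_R0 _ (HD q)).
    rewrite <- (sqrt_sqrt (D q)) at 3 by (left; apply HD); field; lra. }
  assert (h0 : h origin = 1).
  { unfold h, D; rewrite n0, w0.
    replace (1 + (0 * 0 + 0 * 0)) with 1 by ring; rewrite sqrt_1; apply Rinv_1. }
  set (nu2 := fun q => - (n q * h q)).
  assert (Snu2 : smooth_germ nu2)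
    by (apply (smooth_germ_opp (fun q => n q * h q)), smooth_germ_mult; assumption).
  set (nu := fun q => (h q, nu2 q, w q * h q)).
  assert (Snu : smooth_germ3 nu).
  { split; [exact Sh|split; [exact Snu2|]].
    apply (smooth_germ_mult w h); assumption. }
  assert (SPhi : smooth_germ3 (integration phi))
    by (split; [exact SF1|split; [exact SF2 | exact smooth_germ_snd]]).
  assert (Hx3 : forall q, dx (fun z => c3 (integration phi z)) q = 0)
    by (intros q; apply (Derive_const (snd q))).
  assert (Hy3 : forall q, dy (fun z => c3 (integration phi z)) q = 1)
    by (intros q; apply (Derive_id (snd q))).
  assert (E1 : locally origin (fun q => f1 q = n q * p q))
    by (apply filter_imp with (2 := E); intros q Hq; unfold f1; now rewrite Hq).
  assert (E2 : locally origin (fun q => f2 q = p q))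
    by (apply filter_imp with (2 := E); intros q Hq; unfold f2; now rewrite Hq).
  exists nu; split; [constructor|split; [|split]].
  - split; [exact SPhi|].
    unfold integration, origin; simpl.
    now rewrite 2!(RInt_point (V := R_CompleteNormedModule)).
  - exact Snu.
  - apply filter_forall; intros q; rewrite <- (hD q).
    unfold dot, nu, nu2, c1, c2, c3; simpl; unfold D; ring.
  - generalize (filter_and _ _ (dx_primitive_x f1 S1)
                (filter_and _ _ (dx_primitive_x f2 S2) (filter_and _ _ E1 E2))).
    apply filter_imp; intros q [G1 [G2 [G3 G4]]].
    unfold dot, dx3; rewrite Hx3.
    change (dx (primitive_x f1) q * h q + dx (primitive_x f2) q * nu2 q + 0 * (w q * h q) = 0).
    rewrite G1, G2, G3, G4; unfold nu2; ring.
  - apply filter_forall; intros q; unfold dot, dy3; rewrite Hy3.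
    change (dy F1 q * h q + dy F2 q * nu2 q + 1 * (w q * h q) = 0).
    unfold nu2, w; ring.
  - exists (fun v => (linear_part3 (integration phi) v, linear_part3 nu v)).
    split; [apply (filterdiff_pair (integration phi) nu origin
                     (linear_part3 _) (linear_part3 _)); apply smooth_germ3_filterdiff; assumption|].
    assert (Hnx : dx nu2 origin = - dx n origin).
    { transitivity (- (dx n origin * h origin + n origin * dx h origin)).
      - apply is_dx_unique, is_dx_opp, is_dx_mult;
          apply smooth_germ_is_dx; assumption.
      - rewrite h0, n0; ring. }
    intros [v1 v2] [w1 w2] HE.
    apply (f_equal (fun z => (c3 (fst z), c2 (snd z)))) in HE.
    injection HE as A B.
    change (linear_part (fun q => c3 (integration phi q)) (v1, v2)
            = linear_part (fun q => c3 (integration phi q)) (w1, w2)) in A.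
    change (linear_part nu2 (v1, v2) = linear_part nu2 (w1, w2)) in B.
    unfold linear_part in A, B; rewrite Hx3, Hy3 in A; rewrite Hnx in B.
    simpl in A, B.
    assert (v2 = w2) by lra; subst w2; f_equal.
    apply Rmult_eq_reg_r with (- dx n origin); lra.
  - apply filter_forall; intros q; reflexivity.
  - change (dx (primitive_x f2) origin = 0).
    rewrite (locally_singleton _ _ (dx_primitive_x f2 S2) :
               dx (primitive_x f2) origin = f2 origin).
    rewrite (locally_singleton _ _ E2); exact p0.
  - left; unfold nu, nu2; rewrite h0, n0, w0; f_equal; [f_equal|]; ring.
Qed.

(** * Differentiation of normalized Legendrian map-germs *)

Lemma differentiation_pedal Phi :
  normalized_legendrian Phi -> pedal_unfolding_type (differentiation Phi).
Proof.
  intros [nu [[[[Sa [Sb _]] _] [S1 [S2 S3]] Hunit Hdx Hdy [dL [HL Hinj]]]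
             [H3 [b0 Hnu]]]].
  set (a := fun q => c1 (Phi q)) in *.
  set (b := fun q => c2 (Phi q)) in *.
  set (nu1 := fun q => c1 (nu q)) in *.
  set (nu2 := fun q => c2 (nu q)) in *.
  set (nu3 := fun q => c3 (nu q)) in *.
  assert (N1 : nu1 origin <> 0)
    by (unfold nu1; destruct Hnu as [-> | ->]; unfold c1; simpl; lra).
  assert (N2 : nu2 origin = 0)
    by (unfold nu2; destruct Hnu as [-> | ->]; reflexivity).
  assert (N3 : nu3 origin = 0)
    by (unfold nu3; destruct Hnu as [-> | ->]; reflexivity).
  pose proof (smooth_germ_dx a Sa) as Sax; pose proof (smooth_germ_dx b Sb) as Sbx.
  pose proof (smooth_germ_dy a Sa) as Say; pose proof (smooth_germ_dy b Sb) as Sby.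
  set (n := fun q => - (nu2 q * / nu1 q)).
  assert (Sn : smooth_germ n).
  { apply (smooth_germ_opp (fun q => nu2 q * / nu1 q)).
    apply (smooth_germ_mult nu2 (fun q => / nu1 q)); [exact S2|].
    apply smooth_germ_inv; assumption. }
  assert (n0 : n origin = 0) by (unfold n; rewrite N2; ring).
  assert (L1 : locally origin (fun q => nu1 q <> 0))
    by exact (smooth_germ_continuous _ S1 (fun t => t <> 0) (open_neq 0 _ N1)).
  assert (L2 : locally origin (fun q => n q * nu1 q = - nu2 q))
    by (apply filter_imp with (2 := L1); intros q Hq; unfold n; field; exact Hq).
  assert (H3' : locally origin (fun q => dx (fun z => c3 (Phi z)) q = 0 /\
                                       dy (fun z => c3 (Phi z)) q = 1)).
  { generalize (locally_locally _ _ H3); apply filter_imp; intros q Hq; split.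
    - rewrite (dx_ext_loc _ snd q Hq); apply (Derive_const (snd q)).
    - rewrite (dy_ext_loc _ snd q Hq); apply (Derive_id (snd q)). }
  assert (Ea : locally origin (fun q => n q * dx b q = dx a q)).
  { generalize (filter_and _ _ (filter_and _ _ H3' Hdx) L1).
    apply filter_imp; intros q [[[Hq _] Hd] Hn].
    unfold dot, dx3 in Hd; rewrite Hq in Hd.
    change (dx a q * nu1 q + dx b q * nu2 q + 0 * nu3 q = 0) in Hd.
    unfold n; apply Rmult_eq_reg_r with (nu1 q); [|exact Hn].
    replace (- (nu2 q * / nu1 q) * dx b q * nu1 q) with (- (dx b q * nu2 q))
      by (field; exact Hn).
    lra. }
  assert (Ey : locally origin
            (fun q => dy a q * nu1 q + dy b q * nu2 q + nu3 q = 0)).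
  { generalize (filter_and _ _ H3' Hdy).
    apply filter_imp; intros q [[_ Hq] Hd].
    unfold dot, dy3 in Hd; rewrite Hq in Hd.
    change (dy a q * nu1 q + dy b q * nu2 q + 1 * nu3 q = 0) in Hd; lra. }
  assert (a0 : dx a origin = 0)
    by (rewrite <- (locally_singleton _ _ Ea), n0; ring).
  (* The mixed derivatives of [a] agree, and [dx a] is locally the product of
     [n] and [dx b], which both vanish at the origin. *)
  assert (Haxy : dx (dy a) origin = 0).
  { rewrite (smooth_germ_schwarz a Sa).
    transitivity (dy (fun q => n q * dx b q) origin);
      [symmetry; apply dy_ext_loc, Ea|].
    transitivity (dy n origin * dx b origin + n origin * dy (dx b) origin).
    - apply is_dy_unique, is_dy_mult; apply smooth_germ_is_dy; assumption.
    - rewrite n0, b0; ring. }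
  assert (Dnu1 : is_dx nu1 origin (dx nu1 origin)) by (apply smooth_germ_is_dx, S1).
  assert (Dnu2 : is_dx nu2 origin (dx nu2 origin)) by (apply smooth_germ_is_dx, S2).
  assert (Dnu3 : is_dx nu3 origin (dx nu3 origin)) by (apply smooth_germ_is_dx, S3).
  assert (X1 : dx nu1 origin = 0).
  { assert (H : (dx nu1 origin * nu1 origin + nu1 origin * dx nu1 origin)
                + (dx nu2 origin * nu2 origin + nu2 origin * dx nu2 origin)
                + (dx nu3 origin * nu3 origin + nu3 origin * dx nu3 origin) = 0).
    { transitivity (dx (fun q => nu1 q * nu1 q + nu2 q * nu2 q + nu3 q * nu3 q) origin).
      - symmetry; apply is_dx_unique; apply is_dx_plus; [apply is_dx_plus|];
          apply is_dx_mult; assumption.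
      - transitivity (dx (fun _ => 1) origin); [apply dx_ext_loc, Hunit|].
        apply (Derive_const 1). }
    rewrite N2, N3 in H.
    apply Rmult_eq_reg_r with (nu1 origin); [lra | exact N1]. }
  assert (X3 : dx nu3 origin = - (dy b origin * dx nu2 origin)).
  { assert (H : (dx (dy a) origin * nu1 origin + dy a origin * dx nu1 origin)
                + (dx (dy b) origin * nu2 origin + dy b origin * dx nu2 origin)
                + dx nu3 origin = 0).
    { transitivity (dx (fun q => dy a q * nu1 q + dy b q * nu2 q + nu3 q) origin).
      - symmetry; apply is_dx_unique; apply is_dx_plus; [apply is_dx_plus|exact Dnu3];
          apply is_dx_mult; try assumption; apply smooth_germ_is_dx; assumption.
      - transitivity (dx (fun _ => 0) origin); [apply dx_ext_loc, Ey|].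
        apply (Derive_const 0). }
    rewrite Haxy, X1, N2 in H; lra. }
  split; [split; [split; [exact Sax | split; [exact Sbx | exact smooth_germ_snd]]|]|].
  - unfold differentiation; fold a b; rewrite a0, b0; reflexivity.
  - exists n, (dx b); split; [split; assumption|split; [split; assumption|split]].
    + intros Hn.
      assert (X2 : dx nu2 origin = 0).
      { assert (H : dx n origin * nu1 origin + n origin * dx nu1 origin
                    = - dx nu2 origin).
        { transitivity (dx (fun q => n q * nu1 q) origin).
          - symmetry; apply is_dx_unique, is_dx_mult; [|exact Dnu1].
            apply smooth_germ_is_dx, Sn.
          - transitivity (dx (fun q => - nu2 q) origin); [apply dx_ext_loc, L2|].
            apply is_dx_unique, is_dx_opp, Dnu2. }
        rewrite Hn, n0 in H; lra. }
      (* [dL (1, 0)] collects the [x]-derivatives of the six components of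
         [(Phi, nu)]. *)
      assert (Hz : dL (1, 0) = dL (0, 0)).
      { transitivity (((0, 0, 0), (0, 0, 0)) : space * space).
        2: exact (eq_sym (linear_zero _ (proj1 HL))).
        pose proof (filterdiff_is_derive_x _ _ HL) as HD.
        destruct (dL (1, 0)) as [[[l1 l2] l3] [[m1 m2] m3]].
        pose proof (is_derive_fst _ _ _ HD) as HP.
        pose proof (is_derive_snd _ _ _ HD) as HN.
        pose proof (is_derive_unique _ _ _ (is_derive_fst _ _ _ (is_derive_fst _ _ _ HP))) as G1.
        pose proof (is_derive_unique _ _ _ (is_derive_snd _ _ _ (is_derive_fst _ _ _ HP))) as G2.
        pose proof (is_derive_unique _ _ _ (is_derive_snd _ _ _ HP)) as G3.
        pose proof (is_derive_unique _ _ _ (is_derive_fst _ _ _ (is_derive_fst _ _ _ HN))) as G4.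
        pose proof (is_derive_unique _ _ _ (is_derive_snd _ _ _ (is_derive_fst _ _ _ HN))) as G5.
        pose proof (is_derive_unique _ _ _ (is_derive_snd _ _ _ HN)) as G6.
        simpl in G1, G2, G3, G4, G5, G6.
        change (dx a origin = l1) in G1.
        change (dx b origin = l2) in G2.
        change (dx (fun z => c3 (Phi z)) origin = l3) in G3.
        change (dx nu1 origin = m1) in G4.
        change (dx nu2 origin = m2) in G5.
        change (dx nu3 origin = m3) in G6.
        rewrite (proj1 (locally_singleton _ _ H3')) in G3.
        rewrite <- G1, <- G2, <- G3, <- G4, <- G5, <- G6, a0, b0, X3, X1, X2.
        rewrite Rmult_0_r, Ropp_0; reflexivity. }
      apply Hinj in Hz; injection Hz; lra.
    + apply filter_imp with (2 := Ea); intros q Hq.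
      unfold differentiation; fold a b; rewrite Hq; reflexivity.
Qed.

Theorem proposition1 :
  (forall phi : plane -> space,
     pedal_unfolding_type phi -> normalized_legendrian (integration phi)) /\
  (forall Phi : plane -> space,
     normalized_legendrian Phi -> pedal_unfolding_type (differentiation Phi)).
Proof.
  split; [exact integration_normalized | exact differentiation_pedal].
Qed.
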